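(* Let $\mathcal{X} \in \mathbb{C}^{I_1 \times \cdots \times I_M \times J_1 \times \cdots \times J_N }$, $\mathcal{A} \in \mathbb{C}^{K_1 \times \cdots \times K_L \times I_1 \times \cdots \times I_M}$ and $\mathcal{B} \in \mathbb{C}^{J_1 \times \cdots \times J_N \times H_1 \times \cdots \times H_R}$. Then $$\mathcal{X}^\dagger = \mathcal{B}*_R(\mathcal{A}*_M\mathcal{X}*_N\mathcal{B})^\dagger *_L\mathcal{A}$$ if and only if $$(\mathcal{A}*_M\mathcal{X})^\dagger = \mathcal{X}^\dagger *_M\mathcal{A}^\dagger,\quad (\mathcal{X}*_N\mathcal{B})^\dagger = \mathcal{B}^\dagger *_N\mathcal{X}^\dagger,\quad \mathcal{X} = \mathcal{A}^\dagger *_L\mathcal{A}*_M\mathcal{X}\quad\text{and}\quad \mathcal{X} = \mathcal{X}*_N\mathcal{B}*_R\mathcal{B}^\dagger.$$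
   Context: Einstein product: for $\mathcal{A}\in\mathbb{C}^{I_1\times\cdots\times I_M\times J_1\times\cdots\times J_N}$ and $\mathcal{B}\in\mathbb{C}^{J_1\times\cdots\times J_N\times K_1\times\cdots\times K_L}$, $(\mathcal{A}*_N\mathcal{B})_{i_1\ldots i_Mk_1\ldots k_L}=\sum_{j_1,\ldots,j_N}a_{i_1\ldots i_Mj_1\ldots j_N}b_{j_1\ldots j_Nk_1\ldots k_L}$ (the subscript is the number of contracted indices; similarly $*_M,*_L,*_R$). The conjugate transpose $\mathcal{A}^*$ has entries $(\mathcal{A}^* )_{j_1\ldots j_Ni_1\ldots i_M}=\overline{a_{i_1\ldots i_Mj_1\ldots j_N}}$. The Moore-Penrose inverse $\mathcal{A}^\dagger$ of $\mathcal{A}\in\mathbb{C}^{I_1\times\cdots\times I_M\times J_1\times\cdots\times J_N}$ is the unique tensor $\mathcal{Y}\in\mathbb{C}^{J_1\times\cdots\times J_N\times I_1\times\cdots\times I_M}$ with $\mathcal{A}*_N\mathcal{Y}*_M\mathcal{A}=\mathcal{A}$, $\mathcal{Y}*_M\mathcal{A}*_N\mathcal{Y}=\mathcal{Y}$, $(\mathcal{A}*_N\mathcal{Y})^*=\mathcal{A}*_N\mathcal{Y}$, $(\mathcal{Y}*_M\mathcal{A})^*=\mathcal{Y}*_M\mathcal{A}$. *)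

(* Defs.v *)
From mathcomp Require Import all_boot all_order all_algebra.

Set Implicit Arguments.
Unset Strict Implicit.
Unset Printing Implicit Defensive.

Import Order.TTheory GRing.Theory Num.Theory.
Local Open Scope ring_scope.

(* [midx I] is the set of multi-indices (i_1, ..., i_M) with 0 <= i_k < I_k. *)
Definition midx (M : nat) (I : 'I_M -> nat) : finType :=
  {dffun forall k : 'I_M, 'I_(I k)}.

(* C^(I_1 x ... x I_M x J_1 x ... x J_N). The splitting of the M + N indices
   into a group of M and a group of N is kept in the type, since the conjugate
   transpose, the product and the Moore-Penrose inverse all depend on it. *)
Definition tensor (C : Type) (M N : nat) (I : 'I_M -> nat) (J : 'I_N -> nat) :=
  {ffun midx I * midx J -> C}.

Section Einstein.
Variable C : numClosedFieldType.

Definition einprod M N L (I : 'I_M -> nat) (J : 'I_N -> nat) (K : 'I_L -> nat)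
    (A : tensor C I J) (B : tensor C J K) : tensor C I K :=
  [ffun p : midx I * midx K => \sum_(j : midx J) A (p.1, j) * B (j, p.2)].

Definition ctrans M N (I : 'I_M -> nat) (J : 'I_N -> nat)
    (A : tensor C I J) : tensor C J I :=
  [ffun p : midx J * midx I => (A (p.2, p.1))^*].

End Einstein.

(* The number of contracted indices, written as a subscript of the product in
   the literature, is determined by the types of the factors. *)
Notation "A *e B" := (einprod A B) (at level 40, left associativity)
  : ring_scope.

Section MoorePenrose.
Variable C : numClosedFieldType.

Definition is_pinv M N (I : 'I_M -> nat) (J : 'I_N -> nat)
    (A : tensor C I J) (Y : tensor C J I) : bool :=
  [&& A *e Y *e A == A, Y *e A *e Y == Y,
      ctrans (A *e Y) == A *e Y & ctrans (Y *e A) == Y *e A].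

Lemma einprodA M N L P (I : 'I_M -> nat) (J : 'I_N -> nat) (K : 'I_L -> nat)
    (H : 'I_P -> nat)
    (A : tensor C I J) (B : tensor C J K) (D : tensor C K H) :
  A *e (B *e D) = A *e B *e D.
Proof.
apply/ffunP => -[i h]; rewrite !ffunE /=.
under eq_bigr => j _ do rewrite ffunE /= mulr_sumr.
rewrite exchange_big /=; apply: eq_bigr => k _.
by rewrite ffunE /= mulr_suml; apply: eq_bigr => j _; rewrite mulrA.
Qed.

Lemma ctransM M N L (I : 'I_M -> nat) (J : 'I_N -> nat) (K : 'I_L -> nat)
    (A : tensor C I J) (B : tensor C J K) :
  ctrans (A *e B) = ctrans B *e ctrans A.
Proof.
apply/ffunP => -[k i]; rewrite !ffunE /= rmorph_sum /=.
by apply: eq_bigr => j _; rewrite !ffunE /= rmorphM mulrC.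
Qed.

Lemma is_pinv_unique M N (I : 'I_M -> nat) (J : 'I_N -> nat)
    (A : tensor C I J) (Y Z : tensor C J I) :
  is_pinv A Y -> is_pinv A Z -> Y = Z.
Proof.
case/and4P=> /eqP y1 /eqP y2 /eqP y3 /eqP y4.
case/and4P=> /eqP z1 /eqP z2 /eqP z3 /eqP z4.
have eA : A *e Y = A *e Z.
  by rewrite -y3 -{1}z1 -einprodA ctransM y3 z3 einprodA y1.
have eB : Y *e A = Z *e A.
  by rewrite -y4 -{1}z1 -einprodA einprodA ctransM y4 z4 -einprodA [A *e _]einprodA y1.
by rewrite -y2 eB -einprodA eA einprodA z2.
Qed.

Let mct m n (A : 'M[C]_(m, n)) : 'M[C]_(n, m) := (map_mx Num.conj A)^T.

Let mctK m n (A : 'M[C]_(m, n)) : mct (mct A) = A.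
Proof. by apply/matrixP => i j; rewrite !mxE conjCK. Qed.

Let mctM m n p (A : 'M[C]_(m, n)) (B : 'M[C]_(n, p)) :
  mct (A *m B) = mct B *m mct A.
Proof. by rewrite /mct map_mxM trmx_mul. Qed.

Let mctV n (A : 'M[C]_n) : mct (invmx A) = invmx (mct A).
Proof. by rewrite /mct map_invmx trmx_inv. Qed.

Let gram_unit m n (A : 'M[C]_(m, n)) : row_free A -> A *m mct A \in unitmx.
Proof.
move=> fA; rewrite -row_free_unit; apply: inj_row_free => v.
rewrite mulmxA => /(congr1 (mulmx^~ (mct v))).
rewrite mul0mx -(mulmxA (v *m A)) -mctM => e.
have /eqP: v *m A = 0.
  apply/rowP => j; rewrite [RHS]mxE; move: e; set w := v *m A => e.
  have := congr1 (fun X : 'M_1 => X 0 0) e; rewrite !mxE.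
  under eq_bigr => k _ do rewrite !mxE -normCK.
  move/eqP; rewrite psumr_eq0 => [|k _]; last exact: exprn_ge0.
  by move/allP/(_ j (mem_index_enum _)); rewrite expf_eq0 normr_eq0 => /eqP.
by rewrite -[X in _ == X](mul0mx _ A) => /eqP /(row_free_inj fA).
Qed.

Let mx_pinv m n (A : 'M[C]_(m, n)) : exists Y : 'M[C]_(n, m),
  [/\ A *m Y *m A = A, Y *m A *m Y = Y,
      mct (A *m Y) = A *m Y & mct (Y *m A) = Y *m A].
Proof.
have [r [U [V [AE fU fV]]]] : exists r (U : 'M[C]_(m, r)) (V : 'M[C]_(r, n)),
    [/\ A = U *m V, row_full U & row_free V].
  exists (\rank A), (col_base A), (row_base A).
  by rewrite mulmx_base col_base_full row_base_free.
have uV : V *m mct V \in unitmx by exact: gram_unit.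
have uU : mct U *m U \in unitmx.
  rewrite -{2}[U]mctK; apply: gram_unit.
  by rewrite /mct /row_free mxrank_tr mxrank_map.
pose Y := mct V *m invmx (V *m mct V) *m invmx (mct U *m U) *m mct U.
have AY : A *m Y = U *m invmx (mct U *m U) *m mct U.
  by rewrite AE /Y !mulmxA -(mulmxA U V) mulmxK.
have YA : Y *m A = mct V *m invmx (V *m mct V) *m V.
  by rewrite AE /Y mulmxA -[_ *m mct U *m U]mulmxA mulmxKV.
exists Y; split.
- by rewrite AY {1}AE mulmxA -[_ *m mct U *m U]mulmxA mulmxKV // -AE.
- by rewrite YA /Y !mulmxA -[_ *m V *m mct V]mulmxA mulmxKV.
- by rewrite AY !mctM mctV mctM !mctK mulmxA.
- by rewrite YA !mctM mctV mctM !mctK mulmxA.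
Qed.

Lemma is_pinv_exists M N (I : 'I_M -> nat) (J : 'I_N -> nat)
    (A : tensor C I J) : exists Y : tensor C J I, is_pinv A Y.
Proof.
pose t M1 N1 (I1 : 'I_M1 -> nat) (J1 : 'I_N1 -> nat)
    (X : 'M[C]_(#|midx I1|, #|midx J1|)) : tensor C I1 J1 :=
  [ffun p => X (enum_rank p.1) (enum_rank p.2)].
have tM M1 N1 L1 (I1 : 'I_M1 -> nat) (J1 : 'I_N1 -> nat) (K1 : 'I_L1 -> nat)
    X Z : t _ _ I1 J1 X *e t _ _ J1 K1 Z = t _ _ I1 K1 (X *m Z).
  apply/ffunP => -[i k]; rewrite !ffunE mxE /=.
  rewrite [RHS](reindex (@enum_rank (midx J1))) /=.
    by apply: eq_bigr => j _; rewrite !ffunE.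
  by apply: onW_bij; apply: enum_rank_bij.
have tC M1 N1 (I1 : 'I_M1 -> nat) (J1 : 'I_N1 -> nat) X :
    ctrans (t _ _ I1 J1 X) = t _ _ J1 I1 (mct X).
  by apply/ffunP => -[j i]; rewrite !ffunE !mxE.
pose X : 'M[C]_(#|midx I|, #|midx J|) :=
  \matrix_(i, j) A (enum_val i, enum_val j).
have AE : A = t _ _ I J X.
  by apply/ffunP => -[i j]; rewrite !ffunE mxE !enum_rankK.
have [Y [y1 y2 y3 y4]] := mx_pinv X.
exists (t _ _ J I Y); rewrite /is_pinv AE !tM !tC.
by rewrite y1 y2 y3 y4 !eqxx.
Qed.

(* Well defined independently of the choice, by [is_pinv_unique]. *)
Definition pinv M N (I : 'I_M -> nat) (J : 'I_N -> nat) (A : tensor C I J) :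
    tensor C J I :=
  xchoose (is_pinv_exists A).

Lemma pinvP M N (I : 'I_M -> nat) (J : 'I_N -> nat) (A : tensor C I J) :
  is_pinv A (pinv A).
Proof. exact: xchooseP. Qed.

End MoorePenrose.

(* Main.v *)
(* A hermitian G with X G = X also satisfies G X^+ = X^+ (and symmetrically on
   the left), because the ranges of X^* and X^+ coincide. Applied to the
   projectors G = A^+ A and G = B B^+, this turns X^+ = B (A X B)^+ A into
   X = A^+ A X = X B B^+ and back; under these two conditions the remaining
   ones say exactly that B^+ X^+ A^+ is the Moore-Penrose inverse of A X B. *)
Require Import Defs.
From mathcomp Require Import all_boot all_order all_algebra.
From mathcomp Require Import reals complex.

Local Open Scope ring_scope.
Local Open Scope complex_scope.

Section PinvTheory.
Context {C : numClosedFieldType} {M N : nat} {I : 'I_M -> nat} {J : 'I_N -> nat}.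
Implicit Types (X : tensor C I J) (Y : tensor C J I).

Lemma einprod_pinvK X : X *e pinv X *e X = X.
Proof. by case/and4P: (pinvP X) => /eqP. Qed.

Lemma pinv_einprodK X : pinv X *e X *e pinv X = pinv X.
Proof. by case/and4P: (pinvP X) => _ /eqP. Qed.

Lemma ctrans_einprod_pinv X : ctrans (X *e pinv X) = X *e pinv X.
Proof. by case/and4P: (pinvP X) => _ _ /eqP. Qed.

Lemma ctrans_pinv_einprod X : ctrans (pinv X *e X) = pinv X *e X.
Proof. by case/and4P: (pinvP X) => _ _ _ /eqP. Qed.

Lemma pinv_eq X Y :
  X *e Y *e X = X -> Y *e X *e Y = Y ->
  ctrans (X *e Y) = X *e Y -> ctrans (Y *e X) = Y *e X -> pinv X = Y.
Proof.
move=> XYX YXY hXY hYX; apply: (is_pinv_unique (pinvP X)).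
by rewrite /is_pinv XYX YXY hXY hYX !eqxx.
Qed.

End PinvTheory.

Section PinvAbsorption.
Context {C : numClosedFieldType} {M N : nat} {I : 'I_M -> nat} {J : 'I_N -> nat}.
Implicit Types (X : tensor C I J).

Lemma pinvK X : pinv (pinv X) = X.
Proof.
apply: pinv_eq; [exact: pinv_einprodK | exact: einprod_pinvK | |].
  exact: ctrans_pinv_einprod.
exact: ctrans_einprod_pinv.
Qed.

(** Both [G] and [P = pinv X *e X] are hermitian, so [G *e P] is the conjugate transpose of
    [P *e G], which equals [P] because [X] absorbs [G]. Multiplying [G *e P = P] by [pinv X] on the
    right gives the claim. *)
Lemma einprod_pinv_absorb X (G : tensor C J J) :
  ctrans G = G -> X *e G = X -> G *e pinv X = pinv X.
Proof.
move=> hG XG; rewrite -{1}pinv_einprodK einprodA -{1}ctrans_pinv_einprod.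
by rewrite -{1}hG -ctransM -einprodA XG ctrans_pinv_einprod pinv_einprodK.
Qed.

Lemma pinv_einprod_absorb X (G : tensor C I I) :
  ctrans G = G -> G *e X = X -> pinv X *e G = pinv X.
Proof.
move=> hG GX; rewrite -{1}pinv_einprodK -!einprodA [X *e _]einprodA.
rewrite -{1}ctrans_einprod_pinv -{1}hG -ctransM einprodA GX.
by rewrite ctrans_einprod_pinv einprodA pinv_einprodK.
Qed.

(** Since [pinv A *e A] fixes [X], the candidate times [A *e X] collapses to [pinv X *e X]. Three
    Penrose equations follow; the second hypothesis is the remaining one. *)
Lemma pinv_einprodl L (K : 'I_L -> nat) X (A : tensor C K I) :
  pinv A *e A *e X = X ->
  ctrans (A *e X *e pinv X *e pinv A) = A *e X *e pinv X *e pinv A ->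
  pinv (A *e X) = pinv X *e pinv A.
Proof.
move=> AAX h.
have e : pinv X *e pinv A *e (A *e X) = pinv X *e X.
  by rewrite -einprodA [pinv A *e _]einprodA AAX.
apply: pinv_eq.
- by rewrite -einprodA e -einprodA [X *e _]einprodA einprod_pinvK.
- by rewrite e einprodA pinv_einprodK.
- by rewrite einprodA.
- by rewrite e ctrans_pinv_einprod.
Qed.

Lemma pinv_einprodr L (K : 'I_L -> nat) X (B : tensor C J K) :
  X *e B *e pinv B = X ->
  ctrans (pinv B *e pinv X *e X *e B) = pinv B *e pinv X *e X *e B ->
  pinv (X *e B) = pinv B *e pinv X.
Proof.
move=> XBB h.
have e : X *e B *e (pinv B *e pinv X) = X *e pinv X by rewrite einprodA XBB.
apply: pinv_eq.
- by rewrite e einprodA einprod_pinvK.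
- by rewrite -einprodA e -einprodA [pinv X *e _]einprodA pinv_einprodK.
- by rewrite e ctrans_einprod_pinv.
- by rewrite einprodA.
Qed.

End PinvAbsorption.

Theorem theorem3 (R : realType) (M N L P : nat)
    (I : 'I_M -> nat) (J : 'I_N -> nat) (K : 'I_L -> nat) (H : 'I_P -> nat)
    (X : tensor R[i] I J) (A : tensor R[i] K I) (B : tensor R[i] J H) :
  pinv X = B *e pinv (A *e X *e B) *e A
  <->
  [/\ pinv (A *e X) = pinv X *e pinv A,
      pinv (X *e B) = pinv B *e pinv X,
      X = pinv A *e A *e X
    & X = X *e B *e pinv B].
Proof.
split=> [eX | [eAX eXB AAX XBB]].
  set W := pinv (A *e X *e B) in eX.
  have AAX : pinv A *e A *e X = X.
    (* Absorption is used for [pinv X] in place of [X]: by [eX], [pinv X] ends in the factor [A],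
       hence absorbs [pinv A *e A] on the right. *)
    have := @einprod_pinv_absorb _ _ _ _ _ (pinv X); rewrite pinvK.
    apply; first exact: ctrans_pinv_einprod.
    by rewrite eX -einprodA [A *e _]einprodA einprod_pinvK.
  have XBB : X *e B *e pinv B = X.
    have := @pinv_einprod_absorb _ _ _ _ _ (pinv X); rewrite pinvK.
    rewrite -einprodA; apply; first exact: ctrans_einprod_pinv.
    by rewrite eX !einprodA einprod_pinvK.
  (* This and [BBW] reduce the two hermitian conditions below to those of the projectors
     [A *e X *e B *e W] and [W *e (A *e X *e B)]. *)
  have WAA : W *e A *e pinv A = W.
    rewrite -einprodA; apply: pinv_einprod_absorb.
      exact: ctrans_einprod_pinv.
    by rewrite !einprodA einprod_pinvK.
  have BBW : pinv B *e B *e W = W.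
    apply: einprod_pinv_absorb; first exact: ctrans_pinv_einprod.
    by rewrite -!einprodA [B *e _]einprodA einprod_pinvK.
  split=> //.
    apply: pinv_einprodl => //.
    have -> : A *e X *e pinv X *e pinv A = A *e X *e B *e W.
      by rewrite eX -{2}WAA !einprodA.
    exact: ctrans_einprod_pinv.
  apply: pinv_einprodr => //.
  have -> : pinv B *e pinv X *e X *e B = W *e (A *e X *e B).
    by rewrite eX -{2}BBW !einprodA.
  exact: ctrans_pinv_einprod.
(* The reverse order law is applied to [A *e X] and [B]. In its hermitian condition [pinv A *e A]
   cancels against [X], leaving the projector of [X *e B]. *)
have -> : pinv (A *e X *e B) = pinv B *e pinv X *e pinv A.
  rewrite -[RHS]einprodA -eAX; apply: pinv_einprodr.
    by rewrite -!einprodA [X *e _]einprodA -XBB.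
  have -> : pinv B *e pinv (A *e X) *e (A *e X) *e B = pinv (X *e B) *e (X *e B).
    by rewrite eAX eXB -!einprodA [pinv A *e _]einprodA [_ *e A *e _]einprodA -AAX.
  exact: ctrans_pinv_einprod.
(* [pinv X] absorbs [B *e pinv B] on the left, then [pinv A *e A] on the right. *)
rewrite !einprodA einprod_pinv_absorb; last by rewrite einprodA.
  rewrite -einprodA pinv_einprod_absorb //; exact: ctrans_pinv_einprod.
exact: ctrans_einprod_pinv.
Qed.
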